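(* Let $\mathrm{GL}_n(\mathbf{C})$ act on $\mathfrak{sl}_n(\mathbf{C})$ by conjugation. Let \[ U=\mathrm{span}_{\mathbf{C}}\langle E_{11}-E_{nn}\rangle+B_{n-1,2}\leq\mathfrak{sl}_n(\mathbf{C}). \] Then \[ \dim U=(n-1)^2\quad\text{and}\quad \mathrm{diam}_+^{\mathrm{GL}_n(\mathbf{C})}(\mathfrak{sl}_n(\mathbf{C}),U)=3 . \]
   Context: $E_{k\ell}$ denotes the elementary $n\times n$ matrix with $1$ in position $(k,\ell)$ and $0$ elsewhere. For $1\leq i,j\leq n$, \[ B_{ij}=\mathrm{span}_{\mathbf{C}}\langle E_{k\ell}\mid k\leq i,\ \ell\geq j\rangle\cap\mathfrak{sl}_n(\mathbf{C}). \] For a group $G$, a finite-dimensional complex representation $\rho\colon G\to\mathrm{GL}(V)$ and a linear subspace $U\leq V$ that generates $V$ as a $G$-module, the $G$-additive diameter of $V$ with respect to $U$ is \[ \mathrm{diam}_+^G(V,U)=\min\{d \mid \rho(g_1)\cdot U+\dots+\rho(g_d)\cdot U=V \text{ for some } g_1,\dots,g_d\in G\}. \]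
   Formalization: The result is stated for n ≥ 3; for n = 2 the subspace U is the span of E_11−E_22 and E_12, of dimension 2 rather than 1 and diameter 2, and for n = 1 everything is zero, so the claim fails there. *)

(* Defs.v *)
From HB Require Import structures.
From mathcomp Require Import all_boot all_order all_algebra.
From mathcomp Require Import complex.
From mathcomp Require Import reals.

Set Implicit Arguments.
Unset Strict Implicit.
Unset Printing Implicit Defensive.

Import GRing.Theory.
Local Open Scope ring_scope.

(* Invertibility of the operators [rho g] follows from the two laws. *)
Record representation (G : groupType) (F : fieldType) (V : vectType F) := Repr {
  repr_fun :> G -> 'End(V);
  repr1 : repr_fun 1%g = \1%VF;
  reprM : forall g h : G, repr_fun (g * h)%g = (repr_fun g \o repr_fun h)%VF }.

Definition generates (G : groupType) (F : fieldType) (V : vectType F)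
    (rho : representation G V) (U : {vspace V}) : Prop :=
  forall W : {vspace V}, (U <= W)%VS ->
    (forall g : G, (rho g @: W <= W)%VS) -> W = fullv.

Definition covers (G : groupType) (F : fieldType) (V : vectType F)
    (rho : representation G V) (U : {vspace V}) (d : nat) : Prop :=
  exists g : 'I_d -> G, (\sum_(i < d) (rho (g i) @: U))%VS = fullv.

(* [d] is the G-additive diameter of [V] with respect to [U]; the first clause
   is the condition under which the diameter is defined. *)
Definition is_additive_diameter (G : groupType) (F : fieldType)
    (V : vectType F) (rho : representation G V) (U : {vspace V})
    (d : nat) : Prop :=
  [/\ generates rho U, covers rho U d
    & forall d' : nat, covers rho U d' -> (d <= d')%N].

(* The library's 'GL_n[R] is restricted to finite rings. *)
Record GL (F : fieldType) (n : nat) := MkGL {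
  GL_val :> 'M[F]_n;
  GL_unit : GL_val \in unitmx }.

HB.instance Definition _ (F : fieldType) (n : nat) :=
  [isSub for @GL_val F n].
HB.instance Definition _ (F : fieldType) (n : nat) :=
  [Choice of GL F n by <:].

Lemma GL_mul_subproof (F : fieldType) (n : nat) (g h : GL F n) :
  (g : 'M[F]_n) *m h \in unitmx.
Proof. by rewrite unitmx_mul !GL_unit. Qed.

Lemma GL_inv_subproof (F : fieldType) (n : nat) (g : GL F n) :
  invmx g \in unitmx.
Proof. by rewrite unitmx_inv GL_unit. Qed.

Definition GL_one (F : fieldType) (n : nat) : GL F n := MkGL (unitmx1 F n).
Definition GL_mul (F : fieldType) (n : nat) (g h : GL F n) : GL F n :=
  MkGL (GL_mul_subproof g h).
Definition GL_inv (F : fieldType) (n : nat) (g : GL F n) : GL F n :=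
  MkGL (GL_inv_subproof g).

Lemma GL_mulA (F : fieldType) (n : nat) : associative (@GL_mul F n).
Proof. by move=> g h k; apply: val_inj; rewrite /= mulmxA. Qed.
Lemma GL_mul1 (F : fieldType) (n : nat) : left_id (GL_one F n) (@GL_mul F n).
Proof. by move=> g; apply: val_inj; rewrite /= mul1mx. Qed.
Lemma GL_mulr1 (F : fieldType) (n : nat) : right_id (GL_one F n) (@GL_mul F n).
Proof. by move=> g; apply: val_inj; rewrite /= mulmx1. Qed.
Lemma GL_mulV (F : fieldType) (n : nat) :
  left_inverse (GL_one F n) (@GL_inv F n) (@GL_mul F n).
Proof. by move=> g; apply: val_inj; rewrite /= mulVmx ?GL_unit. Qed.
Lemma GL_mulrV (F : fieldType) (n : nat) :
  right_inverse (GL_one F n) (@GL_inv F n) (@GL_mul F n).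
Proof. by move=> g; apply: val_inj; rewrite /= mulmxV ?GL_unit. Qed.

HB.instance Definition _ (F : fieldType) (n : nat) :=
  isGroup.Build (GL F n) (@GL_mulA F n) (@GL_mul1 F n) (@GL_mulr1 F n)
    (@GL_mulV F n) (@GL_mulrV F n).

Definition sl_space (F : fieldType) (n : nat) : {vspace 'M[F]_n} :=
  lker (linfun (@mxtrace F n : 'M[F]_n -> F^o)).

Notation sl F n := (subvs_of (sl_space F n)).

Lemma mem_sl (F : fieldType) (n : nat) (A : 'M[F]_n) :
  (A \in sl_space F n) = (\tr A == 0).
Proof. by rewrite memv_ker lfunE. Qed.

Lemma conj_in_sl (F : fieldType) (n : nat) (g : GL F n) (A : sl F n) :
  (g : 'M[F]_n) *m vsval A *m invmx g \in sl_space F n.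
Proof.
rewrite mem_sl mxtrace_mulC mulmxA mulVmx ?GL_unit // mul1mx.
by rewrite -mem_sl subvsP.
Qed.

Definition conj_fun (F : fieldType) (n : nat) (g : GL F n) (A : sl F n) :
  sl F n := Subvs (conj_in_sl g A).

Lemma conj_fun_linear (F : fieldType) (n : nat) (g : GL F n) :
  linear (conj_fun g).
Proof.
by move=> a A B; apply: val_inj; rewrite /= mulmxDr mulmxDl -scalemxAr -scalemxAl.
Qed.

HB.instance Definition _ (F : fieldType) (n : nat) (g : GL F n) :=
  GRing.isLinear.Build F (sl F n) (sl F n) _ (conj_fun g) (conj_fun_linear g).

Definition conj_lfun (F : fieldType) (n : nat) (g : GL F n) : 'End(sl F n) :=
  linfun (conj_fun g).

Lemma conj_lfun1 (F : fieldType) (n : nat) : conj_lfun (1%g : GL F n) = \1%VF.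
Proof.
apply/lfunP=> A; rewrite !lfunE; apply: val_inj => /=.
by rewrite invmx1 mul1mx mulmx1.
Qed.

Lemma conj_lfunM (F : fieldType) (n : nat) (g h : GL F n) :
  conj_lfun (g * h)%g = (conj_lfun g \o conj_lfun h)%VF.
Proof.
apply/lfunP=> A; rewrite comp_lfunE !lfunE; apply: val_inj => /=.
have -> : invmx ((g : 'M[F]_n) *m h) = invmx h *m invmx g.
  by have := congr1 val (invgM g h).
by rewrite !mulmxA.
Qed.

Definition conj_repr (F : fieldType) (n : nat) :
  representation (GL F n) (sl F n) := Repr (@conj_lfun1 F n) (@conj_lfunM F n).

(* Elementary matrices, with rows and columns numbered from 1 to n. *)
Definition E (F : fieldType) (n k l : nat) : 'M[F]_n :=
  \matrix_(a, b) ((a.+1 == k) && (b.+1 == l))%:R.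

(* The preimage under the inclusion of [sl F n] in the space of matrices is the
   intersection with sl_n, as a subspace of [sl F n]. *)
Definition B (F : fieldType) (n i j : nat) : {vspace sl F n} :=
  (linfun (vsval : sl F n -> 'M[F]_n)
    @^-1: <<[seq E F n k l | k <- index_iota 1 i.+1, l <- index_iota j n.+1]>>)%VS.

Lemma tr_E_diag (F : fieldType) (n k : nat) :
  (0 < k <= n)%N -> \tr (E F n k k) = 1.
Proof.
case: k => // k /= lt_kn; rewrite /mxtrace (bigD1 (Ordinal lt_kn)) //= big1.
  by rewrite mxE /= !eqxx addr0.
by move=> i ne_ik; rewrite mxE andbb eqSS -val_eqE /= in ne_ik *; rewrite (negPf ne_ik).
Qed.

Lemma E11_sub_Enn_in_sl (F : fieldType) (n : nat) :
  E F n 1 1 - E F n n n \in sl_space F n.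
Proof.
rewrite mem_sl linearB /=; case: n => [|n]; first by rewrite /mxtrace !big_ord0 subr0.
by rewrite !tr_E_diag ?ltnSn // subrr.
Qed.

Definition U (F : fieldType) (n : nat) : {vspace sl F n} :=
  (<[Subvs (E11_sub_Enn_in_sl F n)]> + B F n n.-1 2)%VS.

(* Main.v *)
Require Import Defs.
From mathcomp Require Import all_boot all_order all_algebra.
From mathcomp Require Import complex reals.
From HB Require Import structures.
From mathcomp Require Import fingroup perm.

Set Implicit Arguments.
Unset Strict Implicit.
Unset Printing Implicit Defensive.

Import GRing.Theory.
Local Open Scope ring_scope.

(** A traceless matrix lies in the translate g U g^-1 exactly when the vector
    p = g e_1 and the form phi = e_n^* g^-1 (which kills p) are eigenvectors of
    it for opposite eigenvalues.

    Lower bound: for two pairs (p_0, phi_0) and (p_1, phi_1), some nonzero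
    combination Y of the dyads p_0 phi_1 and p_1 phi_0 is trace-orthogonal to
    both translates of U. As its rank is at most 2 < n, Y is not scalar, so its
    orthogonal does not contain sl_n.

    Upper bound: take the pairs of coordinate vectors and forms indexed by
    (r, c) = (1, n), (n, 2), (2, 1). The matrix E_ab with a <> b lies in the
    translate for (r, c) as soon as b <> r and a <> c; since the r's are
    distinct and the c's are distinct, one of the three pairs qualifies. Each
    E_kk - E_22 also lies in one of the translates. *)

(** * Membership in [B] and [U] in terms of matrix entries *)

Lemma span_EP (F : fieldType) (n i j : nat) (M : 'M[F]_n) :
  reflect (forall a b : 'I_n, ~~ ((a < i) && (j <= b.+1))%N -> M a b = 0)
    (M \in <<[seq E F n k l | k <- index_iota 1 i.+1,
                              l <- index_iota j n.+1]>>%VS).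
Proof.
apply: (iffP idP) => [M_span a b nab | M0].
  rewrite (coord_span (X := in_tuple _) M_span) summxE big1 // => h _.
  rewrite mxE; set s := [seq _ | k <- _, l <- _] in h *.
  have /allpairsP[[k l] /= [kin lin ->]] : s`_h \in s by rewrite mem_nth.
  rewrite mxE; case: eqP => [ak | _]; last by rewrite mulr0.
  case: eqP => [bl | _]; last by rewrite mulr0.
  case/negP: nab; move: kin lin.
  by rewrite !mem_index_iota -ak -bl /= !ltnS => -> /andP[->].
rewrite [M]matrix_sum_delta; apply: memv_suml => a _; apply: memv_suml => b _.
have [/andP[ai jb] | nab] := boolP ((a < i) && (j <= b.+1))%N; last first.
  by rewrite M0 // scale0r mem0v.
apply/memvZ/memv_span/allpairsP; exists (a.+1, b.+1); split=> /=.
- by rewrite mem_index_iota /= ltnS.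
- by rewrite mem_index_iota jb !ltnS /=.
- by apply/matrixP=> x y; rewrite !mxE !eqSS.
Qed.

Lemma mem_BP (F : fieldType) (n i j : nat) (A : sl F n) :
  reflect (forall a b : 'I_n, ~~ ((a < i) && (j <= b.+1))%N -> vsval A a b = 0)
    (A \in B F n i j).
Proof. by rewrite /B -memv_preim lfunE; apply: span_EP. Qed.

(* The condition cut out by [U] is that the first basis vector and the last
   coordinate form are eigenvectors with opposite eigenvalues; here these are
   replaced by the [r]-th basis vector and the [c]-th coordinate form. *)
Definition opp_eigen (F : fieldType) (n : nat) (r c : 'I_n) (A : 'M[F]_n) :=
  [/\ forall i, i != r -> A i r = 0, forall j, j != c -> A c j = 0
    & A r r = - A c c].

Lemma mem_UP (F : fieldType) (n : nat) (A : sl F n.+2) :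
  reflect (opp_eigen ord0 ord_max (vsval A)) (A \in U F n.+2).
Proof.
apply: (iffP memv_addP) => [[_ /vlineP[k ->] [D /mem_BP D0 ->]] | [A1 A2 A3]].
  have Dc i : vsval D i ord0 = 0 by apply: D0; rewrite andbF.
  have Dr j : vsval D ord_max j = 0 by apply: D0; rewrite ltnn.
  split=> [i ni | j nj |]; rewrite !mxE ?(Dc, Dr) ?addr0 /= !eqSS.
  - by rewrite -val_eqE /= in ni; rewrite (negPf ni) !andbF subr0 mulr0.
  - by rewrite -val_eqE /= in nj; rewrite (negPf nj) andbF subr0 mulr0.
  - by rewrite !eqxx /= subr0 sub0r mulr1 mulrN1 opprK.
(* The coefficient [k] is forced, since elements of [B] vanish at (1,1). The opposite-eigenvalue
   condition then clears the (n,n) entry of the difference. *)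
set X := Subvs _; pose k := vsval A ord0 ord0.
exists (k *: X); first by rewrite memvZ ?memv_line.
exists (A - k *: X); last by rewrite addrC subrK.
apply/mem_BP=> a b; rewrite negb_and -!leqNgt ltnS leqn0 => nab.
rewrite !mxE /= !eqSS /k.
have [a0|na0] := eqVneq a ord0; have [b0|nb0] := eqVneq b ord0.
- by rewrite a0 b0 /= subr0 mulr1 subrr.
- have b0F : (b == 0%N :> nat) = false by apply/negbTE.
  by move: nab; rewrite a0 b0F orbF /= => /(leq_trans _) H; have := H 1%N isT.
- have a0F : (a == 0%N :> nat) = false by apply/negbTE.
  by rewrite b0 a0F /= andbF subrr mulr0 subr0 A1.
have [a0F b0F] : (a == 0%N :> nat) = false /\ (b == 0%N :> nat) = false.
  by split; apply/negbTE.
move: nab; rewrite b0F orbF => na.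
have -> : a = ord_max by apply/val_inj/eqP; rewrite eqn_leq na -ltnS ltn_ord.
rewrite andbF eqxx sub0r.
have [-> | nb] := eqVneq b ord_max.
  by rewrite eqxx A3 mulrN1 opprK subrr.
rewrite A2 // -[(b : nat) == n.+1]/(val b == val ord_max) val_eqE.
by rewrite (negPf nb) oppr0 mulr0 subrr.
Qed.

(** * Two translates do not suffice *)

(** Conjugation by [g] carries the eigenvector e_1 and the eigenform e_n^* of the preimage [A] to
    [p] and [phi]; [t] is the (1,1) entry of [A]. *)
Lemma opp_eigen_conj (F : fieldType) (n : nat) (g : GL F n.+2) (X : sl F n.+2) :
    X \in (conj_repr F n.+2 g @: U F n.+2)%VS ->
  let p : 'cV_n.+2 := g *m delta_mx ord0 0 in
  let phi : 'rV_n.+2 := delta_mx 0 ord_max *m invmx g in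
  exists t : F, vsval X *m p = t *: p /\ phi *m vsval X = - t *: phi.
Proof.
case/memv_imgP=> A /mem_UP[A1 A2 A3] -> p phi; exists (vsval A ord0 ord0).
rewrite lfunE /= /p /phi; split.
  rewrite mulmxA mulmxKV ?Defs.GL_unit //.
  rewrite -mulmxA -(colE _ (vsval A)) scalemxAr; congr (_ *m _).
  apply/matrixP=> i j; rewrite !mxE (ord1 j) eqxx andbT.
  by have [-> | /A1->] := eqVneq i ord0; rewrite (mulr1, mulr0).
rewrite !mulmxA mulmxKV ?Defs.GL_unit // -(rowE _ (vsval A)).
rewrite scalemxAl; congr (_ *m _).
apply/matrixP=> i j; rewrite !mxE (ord1 i) eqxx A3 opprK.
by have [-> | /A2->] := eqVneq j ord_max; rewrite (mulr1, mulr0).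
Qed.

Lemma mxtrace_delta_mul (F : fieldType) (n : nat) (a b : 'I_n) (Y : 'M[F]_n) :
  \tr (delta_mx a b *m Y) = Y b a.
Proof.
rewrite -(mul_delta_mx (0 : 'I_1)) -mulmxA mxtrace_mulC -mulmxA.
by rewrite -colE -rowE trace_mx11 !mxE.
Qed.

Lemma mxtrace_delta (F : fieldType) (n : nat) (a b : 'I_n) :
  \tr (delta_mx a b : 'M[F]_n) = (a == b)%:R.
Proof. by rewrite -[delta_mx a b]mulmx1 mxtrace_delta_mul mxE eq_sym. Qed.

(** Test against E_ji for i <> j, and against E_ii - E_11. *)
Lemma mxtrace_orth_sl (F : fieldType) (n : nat) (Y : 'M[F]_n.+1) :
  (forall A : 'M_n.+1, \tr A = 0 -> \tr (A *m Y) = 0) -> Y = (Y ord0 ord0)%:M.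
Proof.
move=> orthY; apply/matrixP=> i j; rewrite !mxE.
have [<- | nij] := eqVneq i j; last first.
  by rewrite -mxtrace_delta_mul orthY // mxtrace_delta eq_sym (negPf nij).
apply/eqP; rewrite mulr1n -subr_eq0; apply/eqP.
rewrite -[Y i i]mxtrace_delta_mul -[Y ord0 ord0]mxtrace_delta_mul.
by rewrite -linearB /= -mulmxBl orthY // linearB /= !mxtrace_delta !eqxx subrr.
Qed.

(** Put alpha = phi0 p1 and beta = phi1 p0. The trace of X (a p0 phi1 + b p1 phi0) is t (a beta - b
    alpha) for the first pair and -t (a beta - b alpha) for the second, so the single equation a
    beta = b alpha serves both. *)
Lemma opp_eigen_common_orth (F : fieldType) (n : nat)
    (p0 p1 : 'cV[F]_n) (phi0 phi1 : 'rV[F]_n) :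
    phi0 *m p0 = 0 -> p0 *m phi1 != 0 -> p1 *m phi0 != 0 ->
  exists Y : 'M[F]_n, [/\ Y != 0, (\rank Y <= 2)%N,
    forall X t, X *m p0 = t *: p0 -> phi0 *m X = - t *: phi0 ->
      \tr (X *m Y) = 0
  & forall X t, X *m p1 = t *: p1 -> phi1 *m X = - t *: phi1 ->
      \tr (X *m Y) = 0].
Proof.
move=> phi_p0 p0phi1 p1phi0.
set alpha := (phi0 *m p1) 0 0; set beta := (phi1 *m p0) 0 0.
have alphaE : phi0 *m p1 = alpha%:M by rewrite -mx11_scalar.
have betaE : phi1 *m p0 = beta%:M by rewrite -mx11_scalar.
pose Y a b := a *: (p0 *m phi1) + b *: (p1 *m phi0).
have [[a b] /= ab Yneq0] :
    exists2 ab, ab.1 * beta = ab.2 * alpha & Y ab.1 ab.2 != 0.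
  have [alpha0 | nalpha] := eqVneq alpha 0.
    exists (0, 1); first by rewrite /= alpha0 mul0r mulr0.
    by rewrite /Y scale0r add0r scale1r.
  have [beta0 | nbeta] := eqVneq beta 0.
    exists (1, 0); first by rewrite /= beta0 mul0r mulr0.
    by rewrite /Y scale0r addr0 scale1r.
  exists (alpha, beta); first by rewrite mulrC.
  (* Between [phi0] and [p1] the first dyad dies because phi0 p0 = 0, and beta alpha^2 remains. *)
  apply/eqP=> /(congr1 (fun M => phi0 *m M *m p1)); rewrite mulmx0 mul0mx.
  rewrite /Y mulmxDr mulmxDl -!scalemxAr -!scalemxAl.
  rewrite (mulmxA phi0 p0) phi_p0 !mul0mx scaler0 add0r.
  rewrite mulmxA alphaE -mulmxA alphaE -scalar_mxM scale_scalar_mx.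
  move=> /matrixP/(_ 0 0)/eqP.
  by rewrite !mxE mulr1n !mulf_eq0 (negPf nalpha) (negPf nbeta).
have tr_dyad X (p : 'cV[F]_n) (phi : 'rV[F]_n) :
    \tr (X *m (p *m phi)) = (phi *m (X *m p)) 0 0.
  by rewrite mulmxA mxtrace_mulC trace_mx11.
have trE X : \tr (X *m Y a b) =
    a * (phi1 *m (X *m p0)) 0 0 + b * (phi0 *m X *m p1) 0 0.
  by rewrite mulmxDr -!scalemxAr linearD !linearZ /= !tr_dyad (mulmxA phi0).
have trE' X : \tr (X *m Y a b) =
    a * (phi1 *m X *m p0) 0 0 + b * (phi0 *m (X *m p1)) 0 0.
  by rewrite trE !mulmxA.
exists (Y a b); split=> // [|X t Xp phiX|X t Xp phiX].
- have rk1 k (p : 'cV[F]_n) (phi : 'rV[F]_n) : (\rank (k *: (p *m phi)) <= 1)%N.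
    apply: leq_trans (mxrank_scale _ _) _.
    exact: leq_trans (mxrankM_maxr _ _) (rank_leq_row _).
  exact: leq_trans (mxrank_add _ _) (leq_add (rk1 _ _ _) (rk1 _ _ _)).
- rewrite trE Xp phiX -scalemxAr -scalemxAl alphaE betaE !mxE !mulr1n.
  by rewrite mulNr mulrN !(mulrCA _ t) ab subrr.
- rewrite trE' Xp phiX -scalemxAr -scalemxAl alphaE betaE !mxE !mulr1n.
  by rewrite mulNr mulrN !(mulrCA _ t) ab addNr.
Qed.

Lemma not_covers2 (F : fieldType) (n : nat) (g0 g1 : GL F n.+3) :
  (conj_repr F n.+3 g0 @: U F n.+3 + conj_repr F n.+3 g1 @: U F n.+3)%VS
    <> fullv.
Proof.
move=> full.
(* This dyad is g E_1n h^-1. *)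
have p_phi_neq0 (g h : GL F n.+3) : (g *m delta_mx ord0 (0 : 'I_1)) *m
    (delta_mx (0 : 'I_1) ord_max *m invmx h) != 0 :> 'M[F]_n.+3.
  apply/eqP=> /(congr1 (fun M => invmx g *m M *m h)).
  rewrite mulmx0 mul0mx !mulmxA mulVmx ?Defs.GL_unit // mul1mx.
  rewrite mulmxKV ?Defs.GL_unit // mul_delta_mx.
  by move/matrixP/(_ ord0 ord_max)/eqP; rewrite !mxE !eqxx oner_eq0.
have phi_p0 (g : GL F n.+3) : (delta_mx (0 : 'I_1) ord_max *m invmx g) *m
    (g *m delta_mx ord0 (0 : 'I_1)) = 0.
  by rewrite mulmxA mulmxKV ?Defs.GL_unit // mul_delta_mx_0.
have [Y [Yneq0 rkY orth0 orth1]] :=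
  opp_eigen_common_orth (phi_p0 g0) (p_phi_neq0 g0 g1) (p_phi_neq0 g1 g0).
have Yscal : Y = (Y ord0 ord0)%:M.
  apply: mxtrace_orth_sl => A /eqP; rewrite -mem_sl => Asl.
  have: Subvs Asl \in (conj_repr F n.+3 g0 @: U F n.+3
                     + conj_repr F n.+3 g1 @: U F n.+3)%VS.
    by rewrite full memvf.
  case/memv_addP=> X0 /opp_eigen_conj[t0 [Xp0 phiX0]].
  case=> X1 /opp_eigen_conj[t1 [Xp1 phiX1]] /(congr1 vsval) /= ->.
  rewrite mulmxDl linearD /=.
  by rewrite (orth0 _ _ Xp0 phiX0) (orth1 _ _ Xp1 phiX1) addr0.
move: rkY Yneq0; rewrite Yscal -scalemx1.
have [-> | nY0] := eqVneq (Y ord0 ord0) 0; first by rewrite scale0r eqxx.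
by rewrite mxrank_scale_nz // mxrank1.
Qed.

Lemma covers_geq3 (F : fieldType) (n d : nat) :
  covers (conj_repr F n.+3) (U F n.+3) d -> (3 <= d)%N.
Proof.
case=> g full; rewrite leqNgt; apply/negP => d_lt3.
(* [h] pads [g] with the identity, so that d = 0, 1 and 2 are treated alike. *)
pose h k : GL F n.+3 := if insub k is Some i then g i else 1%g.
apply: (@not_covers2 F n (h 0%N) (h 1%N)); apply/eqP.
rewrite eqEsubv subvf -full; apply/subv_sumP => i _.
have -> : g i = h i by rewrite /h valK.
case: i => [[|[|k]] ltk]; [exact: addvSl | exact: addvSr |].
by have := leq_trans ltk (d_lt3 : (d <= 2)%N).
Qed.

(** * Three translates suffice *)

Definition GL_perm (F : fieldType) (n : nat) (s : 'S_n) : GL F n :=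
  MkGL (unitmx_perm F s).

Lemma opp_eigen_translate (F : fieldType) (n : nat) (r c : 'I_n.+2) : r != c ->
  exists g : GL F n.+2, forall C : sl F n.+2,
    opp_eigen r c (vsval C) -> C \in (conj_repr F n.+2 g @: U F n.+2)%VS.
Proof.
move=> nrc.
(* The second transposition sends the image of n under the first to [c]. It fixes [r], which differs
   from both. *)
pose s : 'S_n.+2 := (tperm ord0 r * tperm (tperm ord0 r ord_max) c)%g.
have s0 : s ord0 = r.
  rewrite permM tpermL; apply: tpermD; last by rewrite eq_sym.
  by rewrite -{2}(tpermL ord0 r) (inj_eq perm_inj).
have smax : s ord_max = c by rewrite permM tpermL.
exists (GL_perm F s)^-1%g => C [C1 C2 C3].
have -> : C = conj_repr F n.+2 (GL_perm F s)^-1%g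
    (conj_repr F n.+2 (GL_perm F s) C).
  by rewrite -comp_lfunE -reprM mulVg repr1 id_lfunE.
apply/memv_img/mem_UP; rewrite lfunE /=.
have CsE i j : (perm_mx s *m vsval C *m invmx (perm_mx s)) i j =
    vsval C (s i) (s j).
  rewrite [invmx _](_ : _ = perm_mx s^-1%g); last first.
    exact: (esym (perm_mxV _ s)).
  by rewrite -col_permE -row_permE !mxE.
split=> [i ni | j nj |]; rewrite !CsE ?s0 ?smax //.
  by rewrite C1 // -s0 (inj_eq perm_inj).
by rewrite C2 // -smax (inj_eq perm_inj).
Qed.

Lemma covers3 (F : fieldType) (n : nat) :
  covers (conj_repr F n.+3) (U F n.+3) 3.
Proof.
pose e : 'I_n.+3 := lift ord0 ord0; pose m : 'I_n.+3 := ord_max.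
have ne0 : e != ord0 by [].
have [g1 g1P] := @opp_eigen_translate F n.+1 ord0 m isT.
have [g2 g2P] := opp_eigen_translate F (isT : m != e).
have [g3 g3P] := opp_eigen_translate F ne0.
exists (fun i : 'I_3 => nth 1%g [:: g1; g2; g3] i).
rewrite !big_ord_recl big_ord0 /=; set W := (_ + _)%VS.
(* The image of [W] among all matrices, where sums need no proofs of trace zero. *)
pose W' : {vspace 'M[F]_n.+3} :=
  (linfun (vsval : sl F n.+3 -> 'M[F]_n.+3) @: W)%VS.
have memW' (M : 'M[F]_n.+3) : \tr M = 0 ->
    [\/ opp_eigen ord0 m M, opp_eigen m e M | opp_eigen e ord0 M] -> M \in W'.
  move/eqP; rewrite -mem_sl => Msl oppM.
  have -> : M = linfun (vsval : sl F n.+3 -> 'M[F]_n.+3) (Subvs Msl).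
    by rewrite lfunE.
  apply: memv_img; rewrite /W addv0.
  case: oppM => [/(g1P (Subvs Msl)) | /(g2P (Subvs Msl)) | /(g3P (Subvs Msl))];
    apply/subvP.
  - exact: addvSl.
  - exact: subv_trans (addvSl _ _) (addvSr _ _).
  - exact: subv_trans (addvSr _ _) (addvSr _ _).
have offdiag a b : a != b -> delta_mx a b \in W'.
  move=> nab; apply: memW'; first by rewrite mxtrace_delta (negPf nab).
  have opp_delta r c : b != r -> a != c ->
      opp_eigen r c (delta_mx a b : 'M[F]_n.+3).
    rewrite ![_ == r]eq_sym ![_ == c]eq_sym => nbr nac.
    split=> [i _ | j _ |]; rewrite !mxE.
    - by rewrite (negPf nbr) andbF.
    - by rewrite (negPf nac).
    - by rewrite (negPf nbr) (negPf nac) andbF oppr0.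
  (* The pair (1, n) fails only in column 1 or row n; there one of the other two pairs works. *)
  have [b0 | nb0] := eqVneq b ord0; last have [am | nam] := eqVneq a m.
  - subst b; have [ae | nae] := eqVneq a e.
      by apply: Or33; apply: opp_delta.
    by apply: Or32; apply: opp_delta; rewrite // eq_sym.
  - subst a; have [be | nbe] := eqVneq b e.
      by apply: Or32; apply: opp_delta; rewrite // be.
    by apply: Or33; apply: opp_delta.
  - by apply: Or31; apply: opp_delta.
have diag k : delta_mx k k - delta_mx e e \in W'.
  have [-> | nke] := eqVneq k e; first by rewrite subrr mem0v.
  apply: memW'; first by rewrite linearB /= !mxtrace_delta !eqxx subrr.
  (* A diagonal matrix satisfies the eigenvector conditions for any [r] and [c]. The hypothesis,
     once cast to [F], says that its entries at [r] and [c] are opposite. *)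
  have opp_diag r c : ((r == k) + (c == k) = (r == e) + (c == e))%N ->
      opp_eigen r c (delta_mx k k - delta_mx e e : 'M[F]_n.+3).
    move=> /(congr1 (fun x => x%:R : F)); rewrite !natrD => rc.
    split=> [i ni | j nj |]; rewrite !mxE.
    - have nir x : (i == x) && (r == x) = false.
        by apply/negP=> /andP[/eqP<- /eqP ri]; rewrite ri eqxx in ni.
      by rewrite !nir subrr.
    - have nir x : (c == x) && (j == x) = false.
        by apply/negP=> /andP[/eqP<- /eqP jc]; rewrite jc eqxx in nj.
      by rewrite !nir subrr.
    - rewrite !andbb; apply/eqP; rewrite -addr_eq0 addrACA -opprD subr_eq0.
      exact/eqP.
  have [k0 | nk0] := eqVneq k ord0.
    by apply: Or33; apply: opp_diag; rewrite k0.
  have [km | nkm] := eqVneq k m.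
    by apply: Or32; apply: opp_diag; rewrite km !eqxx.
  apply: Or31; apply: opp_diag.
  by rewrite !(eq_sym _ k) (negPf nk0) (negPf nkm).
apply/eqP; rewrite eqEsubv subvf; apply/subvP=> C _.
have: vsval C \in W'.
  have /eqP trC : \tr (vsval C) == 0 by rewrite -mem_sl subvsP.
  (* The corrections by E_22 on the diagonal add up to tr(C) E_22 = 0. *)
  have -> : vsval C =
      \sum_a \sum_b vsval C a b *: (delta_mx a b - (a == b)%:R *: delta_mx e e).
    under eq_bigr do under eq_bigr do rewrite scalerBr.
    under eq_bigr do rewrite sumrB.
    rewrite sumrB -matrix_sum_delta [X in _ - X](_ : _ = 0) ?subr0 //.
    rewrite -[RHS](scale0r (delta_mx e e)) -trC /mxtrace scaler_suml.
    apply: eq_bigr => a _; rewrite (bigD1 a) //= eqxx scale1r.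
    rewrite big1 ?addr0 // => b nb.
    by rewrite eq_sym (negPf nb) scale0r scaler0.
  apply: memv_suml => a _; apply: memv_suml => b _; apply: memvZ.
  have [-> | nab] := eqVneq a b; first by rewrite scale1r.
  by rewrite scale0r subr0 offdiag.
by case/memv_imgP=> C' C'W; rewrite lfunE /= => /val_inj->.
Qed.

(** A stable subspace containing [W] contains all its translates, hence their sum. *)
Lemma covers_generates (G : groupType) (F : fieldType) (V : vectType F)
    (rho : representation G V) (W : {vspace V}) (d : nat) :
  covers rho W d -> generates rho W.
Proof.
case=> g full W' sWW' stabW'; apply/eqP; rewrite eqEsubv subvf -full.
by apply/subv_sumP=> i _; apply: subv_trans (limgS _ sWW') (stabW' _).
Qed.

(** * The dimension of [U] *)

(* The block of rows below n and columns above 1 of a matrix in U is arbitrary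
   up to a vanishing diagonal sum; adding the remaining parameter A_11 to the
   (2,2) entry identifies U with the space of all such blocks. *)
Definition U_block (F : fieldType) (n : nat) (A : sl F n.+3) : 'M[F]_n.+2 :=
  let e : 'I_n.+3 := lift ord0 ord0 in
  \matrix_(i, j) (vsval A (lift ord_max i) (lift ord0 j)
    + vsval A ord0 ord0 * delta_mx e e (lift ord_max i) (lift ord0 j)).

Lemma U_block_linear (F : fieldType) (n : nat) : linear (@U_block F n).
Proof.
move=> k A A'; apply/matrixP=> i j; rewrite !mxE.
by rewrite mulrDl mulrDr !mulrA addrACA.
Qed.

HB.instance Definition _ (F : fieldType) (n : nat) :=
  GRing.isLinear.Build F (sl F n.+3) 'M[F]_n.+2 _ (@U_block F n)
    (@U_block_linear F n).

Lemma dim_U (F : fieldType) (n : nat) : \dim (U F n.+3) = (n.+2 ^ 2)%N.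
Proof.
pose f := linfun (@U_block F n).
pose e : 'I_n.+3 := lift ord0 ord0; pose m : 'I_n.+3 := ord_max.
(* [T] meets the conditions defining [U] except trace zero, and the formula of [U_block] sends it to
   0. Kernel elements are multiples of [T], hence zero by their trace; adding a multiple of [T]
   corrects a trace without changing the block. *)
pose T : 'M[F]_n.+3 := delta_mx ord0 ord0 - delta_mx m m - delta_mx e e.
have trT : \tr T = -1.
  by rewrite /T !linearB /= !mxtrace_delta !eqxx subrr sub0r.
have f_inj : (U F n.+3 :&: lker f = 0)%VS.
  apply/eqP; rewrite -subv0; apply/subvP=> A.
  rewrite memv_cap memv_ker lfunE /= => /andP[/mem_UP[A1 A2 A3] /eqP fA0].
  have AE : vsval A = vsval A ord0 ord0 *: T.
    apply/matrixP=> a b; rewrite !mxE.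
    have [i ->|->] := unliftP ord_max a.
      have [j ->|->] := unliftP ord0 b.
        have /eqP := congr1 (fun M : 'M_n.+2 => M i j) fA0; rewrite !mxE.
        rewrite addr_eq0 => /eqP->.
        by rewrite (eq_sym _ m) (negPf (neq_lift _ _)) andbF subrr sub0r mulrN.
      have [-> | na] := eqVneq (lift ord_max i) ord0.
        by rewrite !eqxx !andbF !subr0 mulr1.
      by rewrite A1 // !andbF !subr0 mulr0.
    have [-> | nb] := eqVneq b m.
      by rewrite /= !eqxx sub0r subr0 mulrN mulr1 A3 opprK.
    by rewrite A2 // !andbF /= !subr0 mulr0.
  have /eqP : \tr (vsval A) == 0 by rewrite -mem_sl subvsP.
  rewrite AE linearZ /= trT mulrN1 => /eqP; rewrite oppr_eq0 => /eqP A0.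
  by rewrite memv0; apply/eqP/val_inj; rewrite /= AE A0 scale0r.
rewrite -(limg_dim_eq f_inj) (_ : (f @: _)%VS = fullv) ?dimvf ?dim_matrix //.
apply/eqP; rewrite eqEsubv subvf; apply/subvP=> M _.
(* [S] is [M] bordered by a zero first column and a zero last row. *)
pose S : 'M[F]_n.+3 := \matrix_(a, b)
  if unlift ord_max a is Some i then
    if unlift ord0 b is Some j then M i j else 0 else 0.
have Asl : S + \tr S *: T \in sl_space F n.+3.
  by rewrite mem_sl linearD linearZ /= trT mulrN1 subrr.
have -> : M = f (Subvs Asl).
  rewrite lfunE /=; apply/matrixP=> i j; rewrite !mxE !liftK unlift_none.
  rewrite (eq_sym _ m) (negPf (neq_lift _ _)).
  by case: unlift => [k|]; rewrite !eqxx !andbF /= !subr0 sub0r add0r mulr1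
    mulrN subrK.
apply/memv_img/mem_UP; split=> [a na|b nb|] /=; rewrite !mxE.
- by rewrite unlift_none (negPf na) !andbF !subr0 mulr0 addr0; case: unlift.
- by rewrite unlift_none (negPf nb) !andbF !subr0 mulr0 addr0.
- rewrite !unlift_none !eqxx /= !subr0 sub0r mulr1 mulrN1 add0r opprK.
  by case: unlift => [k|]; rewrite add0r.
Qed.

Theorem proposition4p4 (R : realType) (n : nat) (n_ge3 : (3 <= n)%N) :
  (\dim (U R[i] n) = (n - 1) ^ 2)%N /\
  is_additive_diameter (conj_repr R[i] n) (U R[i] n) 3.
Proof.
case: n n_ge3 => [|[|[|n]]] // _; rewrite subn1 dim_U; split=> //.
have cov := covers3 R[i] n.
by split=> //; [apply: covers_generates cov | apply: covers_geq3].
Qed.
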